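(* Let $\boldsymbol{K}\in\mathbb{R}^{N_l\times N}$, $\boldsymbol{r}\in\mathbb{R}^{N_l}$, and let $\boldsymbol{C}\in\mathbb{R}^{k\times N}$ have full row rank $k\le N$. For $\alpha\ge 0$ let $$\boldsymbol{n}_\alpha:=\underset{\boldsymbol{n}\in\mathbb{R}^N}{\mathrm{argmin}}\ \tfrac12\|\boldsymbol{K}\boldsymbol{n}-\boldsymbol{r}\|_2^2+\tfrac12\alpha\|\boldsymbol{n}\|_2^2\quad\text{s.t.}\quad -\boldsymbol{C}\boldsymbol{n}\le 0.$$ If $\|\boldsymbol{K}\boldsymbol{n}_\alpha-\boldsymbol{r}\|_2<\|\boldsymbol{r}\|_2$ for all $\alpha\in[0,\infty)$ (equivalently, $\boldsymbol{n}_\alpha\neq 0$ for all $\alpha\in[0,\infty)$), then $\boldsymbol{n}_\alpha\neq\boldsymbol{n}_\beta$ for all $\alpha>\beta\ge 0$.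
   Context: Vector inequalities are componentwise and $\|\cdot\|_2$ is the Euclidean norm. For $\alpha>0$ the minimizer is unique; for $\alpha=0$, $\boldsymbol{n}_0$ denotes a fixed minimizer of the problem. *)

(* Defs.v *)
From HB Require Import structures.
From mathcomp Require Import all_boot all_order all_algebra.
From mathcomp Require Import reals.

Set Implicit Arguments.
Unset Strict Implicit.
Unset Printing Implicit Defensive.

Import Order.TTheory GRing.Theory Num.Theory.
Local Open Scope ring_scope.

(* The norm `|v| of MathComp-Analysis on column vectors is the maximum norm,
   so the Euclidean norm is defined separately. *)
Definition norm2 (R : realType) (m : nat) (v : 'cV[R]_m) : R :=
  Num.sqrt (\sum_(i < m) v i 0 ^+ 2).

Definition lev (R : realType) (m : nat) (u v : 'cV[R]_m) : Prop :=
  forall i : 'I_m, u i 0 <= v i 0.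

(* A predicate, not a function: a minimizer need not be unique. *)
Definition is_argmin (R : realType) (T : Type) (f : T -> R) (A : T -> Prop)
    (x : T) : Prop :=
  A x /\ forall y : T, A y -> f x <= f y.

Definition tikhonov (R : realType) (Nl N : nat) (K : 'M[R]_(Nl, N))
    (r : 'cV[R]_Nl) (alpha : R) (x : 'cV[R]_N) : R :=
  2^-1 * norm2 (K *m x - r) ^+ 2 + 2^-1 * alpha * norm2 x ^+ 2.

Definition feasible (R : realType) (k N : nat) (C : 'M[R]_(k, N))
    (x : 'cV[R]_N) : Prop :=
  lev (- C *m x) 0.

(* Main.v *)
(* The feasible set is a cone, so it contains the ray through any minimizer x.
   Minimality of t = 1 on this ray gives |Kx|^2 + alpha |x|^2 = <Kx, r>. A common
   minimizer for alpha <> beta therefore satisfies |x| = 0, whereas x = 0 has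
   residual |r|. *)

Require Import Defs.
From HB Require Import structures.
From mathcomp Require Import all_boot all_order all_algebra.
From mathcomp Require Import reals.
From mathcomp Require Import ring lra.

Import Order.TTheory GRing.Theory Num.Theory.
Local Open Scope ring_scope.

Lemma sqr_norm2 (R : realType) (m : nat) (v : 'cV[R]_m) :
  norm2 v ^+ 2 = \sum_(i < m) v i 0 ^+ 2.
Proof. by rewrite /norm2 sqr_sqrtr // sumr_ge0 // => i _; exact: sqr_ge0. Qed.

Lemma norm2_ge0 (R : realType) (m : nat) (v : 'cV[R]_m) : 0 <= norm2 v.
Proof. exact: sqrtr_ge0. Qed.

Lemma norm2N (R : realType) (m : nat) (v : 'cV[R]_m) : norm2 (- v) = norm2 v.
Proof.
by rewrite /norm2; congr Num.sqrt; apply: eq_bigr => i _; rewrite mxE sqrrN.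
Qed.

Lemma sqr_norm2_eq0 {R : realType} {m : nat} {v : 'cV[R]_m} :
  norm2 v ^+ 2 = 0 -> v = 0.
Proof.
rewrite sqr_norm2 => /eqP; rewrite psumr_eq0 => [/allP h|i _]; last exact: sqr_ge0.
apply/matrixP => i j; rewrite ord1 mxE.
by apply/eqP; rewrite -sqrf_eq0; apply: h; rewrite mem_index_enum.
Qed.

(** With [u] equal to [K *m x] and [v] equal to [r], this displays the squared residual along the
    ray through [x] as a quadratic polynomial in [t]. *)
Lemma sqr_norm2_scaleB (R : realType) (m : nat) (u v : 'cV[R]_m) (t : R) :
  norm2 (t *: u - v) ^+ 2 =
  t ^+ 2 * norm2 u ^+ 2 - 2 * t * (\sum_(i < m) u i 0 * v i 0) + norm2 v ^+ 2.
Proof.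
rewrite !sqr_norm2 !mulr_sumr -sumrB -big_split /=.
by apply: eq_bigr => i _; rewrite !mxE; ring.
Qed.

Lemma sqr_norm2_scale (R : realType) (m : nat) (u : 'cV[R]_m) (t : R) :
  norm2 (t *: u) ^+ 2 = t ^+ 2 * norm2 u ^+ 2.
Proof.
by rewrite !sqr_norm2 mulr_sumr; apply: eq_bigr => i _; rewrite mxE exprMn.
Qed.

Lemma feasible_scale {R : realType} {k N : nat} {C : 'M[R]_(k, N)}
    {t : R} {x : 'cV[R]_N} : 0 <= t -> feasible C x -> feasible C (t *: x).
Proof.
move=> t0 Cx i; rewrite -scalemxAr mxE [X in _ <= X]mxE.
by move: (Cx i); rewrite [X in _ <= X]mxE => Cxi; apply: mulr_ge0_le0.
Qed.

Lemma feasible0 {R : realType} {k N : nat} (C : 'M[R]_(k, N)) : feasible C 0.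
Proof. by move=> i; rewrite mulmx0. Qed.

Lemma tikhonov0 (R : realType) (Nl N : nat) (K : 'M[R]_(Nl, N))
    (r : 'cV[R]_Nl) (alpha : R) :
  tikhonov K r alpha 0 = 2^-1 * norm2 r ^+ 2.
Proof.
rewrite /tikhonov mulmx0 sub0r norm2N sqr_norm2 [norm2 0 ^+ 2]sqr_norm2.
by rewrite [X in _ + _ * X]big1 ?mulr0 ?addr0 // => i _; rewrite mxE expr0n.
Qed.

(** For [a > 0] the value at [t = 1] exceeds the value at the vertex [b / a] by
    [(a - b) ^+ 2 / (2 * a)], so minimality at 1 forces this gap to vanish. For [a = 0] the function
    is linear and is handled separately. *)
Lemma quadratic_argmin1 (R : realType) (a b : R) : 0 <= a ->
  (forall t, 0 <= t -> 2^-1 * a - b <= 2^-1 * a * t ^+ 2 - b * t) -> a = b.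
Proof.
move=> a0 h; have h0 := h 0 (lexx _); have [a1|aN0] := eqVneq a 0.
  (* The points [t = 0] and [t = 2] lie on either side of 1, so they bound the slope from both sides
     and give [b = 0]. *)
  by have := h 2 (ler0n _ 2); rewrite a1 in h0 *; lra.
have apos : 0 < a by rewrite lt_def aN0.
(* The test point [t = 0] gives [b >= a / 2], so the vertex is an admissible [t]. *)
have b0 : 0 <= b / a by apply: divr_ge0 => //; lra.
have := h _ b0.
have -> : 2^-1 * a * (b / a) ^+ 2 - b * (b / a) = - (2^-1 * b ^+ 2 / a) by field.
rewrite -subr_ge0.
have -> : - (2^-1 * b ^+ 2 / a) - (2^-1 * a - b) = - ((a - b) ^+ 2 / (2 * a)).
  by field.
rewrite oppr_ge0 pmulr_lle0 ?invr_gt0 ?mulr_gt0 // => hab.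
have /eqP : (a - b) ^+ 2 == 0 by rewrite eq_le hab sqr_ge0.
by move/eqP; rewrite sqrf_eq0 subr_eq0 => /eqP.
Qed.

Lemma argmin_ray {R : realType} {Nl N k : nat} {K : 'M[R]_(Nl, N)}
    {r : 'cV[R]_Nl} {C : 'M[R]_(k, N)} {alpha : R} {x : 'cV[R]_N} :
  0 <= alpha -> is_argmin (tikhonov K r alpha) (feasible C) x ->
  norm2 (K *m x) ^+ 2 + alpha * norm2 x ^+ 2 = \sum_(i < Nl) (K *m x) i 0 * r i 0.
Proof.
move=> al0 [Cx xmin]; apply: quadratic_argmin1.
  by apply: addr_ge0; [|apply: mulr_ge0 => //]; exact: sqr_ge0.
move=> t t0; have := xmin _ (feasible_scale t0 Cx).
rewrite /tikhonov -scalemxAr sqr_norm2_scaleB sqr_norm2_scale.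
(* Writing [K *m x] as [1 *: (K *m x)] expands the value at [x] by the same formula, with [t = 1];
   the terms in [r] alone then cancel. *)
rewrite -[K *m x in X in X <= _]scale1r sqr_norm2_scaleB.
set p := norm2 _ ^+ 2; set q := norm2 _ ^+ 2; set s := \sum_(_ < _) _.
set w := norm2 _ ^+ 2; lra.
Qed.

Theorem theorem3p5 (R : realType) (Nl N k : nat)
    (K : 'M[R]_(Nl, N)) (r : 'cV[R]_Nl) (C : 'M[R]_(k, N))
    (hkN : (k <= N)%N) (hC : row_free C)
    (n : R -> 'cV[R]_N)
    (hn : forall alpha : R, 0 <= alpha ->
       is_argmin (tikhonov K r alpha) (feasible C) (n alpha)) :
  ((forall alpha : R, 0 <= alpha -> norm2 (K *m n alpha - r) < norm2 r) <->
   (forall alpha : R, 0 <= alpha -> n alpha <> 0)) /\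
  ((forall alpha : R, 0 <= alpha -> norm2 (K *m n alpha - r) < norm2 r) ->
   forall alpha beta : R, 0 <= beta -> beta < alpha -> n alpha <> n beta).
Proof.
have sqr_lt (u v : 'cV[R]_Nl) : (norm2 u < norm2 v) = (norm2 u ^+ 2 < norm2 v ^+ 2).
  by rewrite ltr_sqr // nnegrE norm2_ge0.
have nN0 : (forall alpha : R, 0 <= alpha -> norm2 (K *m n alpha - r) < norm2 r) ->
    forall alpha : R, 0 <= alpha -> n alpha <> 0.
  move=> h alpha /h + n0.
  by rewrite n0 mulmx0 sub0r norm2N ltxx.
(* Comparison with the feasible point 0, whose objective value is half of the squared norm of [r]
   for every [alpha]. *)
have le0 alpha : 0 <= alpha ->
    norm2 (K *m n alpha - r) ^+ 2 + alpha * norm2 (n alpha) ^+ 2 <= norm2 r ^+ 2.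
  move=> al0; have [_ /(_ _ (feasible0 C))] := hn _ al0.
  by rewrite tikhonov0 /tikhonov; lra.
have pos alpha : n alpha <> 0 -> 0 < norm2 (n alpha) ^+ 2.
  move=> nz; rewrite lt_def sqr_ge0 andbT.
  by apply/eqP => /sqr_norm2_eq0.
split; first split=> // nz alpha al0.
- rewrite sqr_lt.
  have [->|alN0] := eqVneq alpha 0; last first.
    have alp : 0 < alpha by rewrite lt_def alN0.
    (* The strictly positive penalty makes the bound on the residual strict. *)
    have := mulr_gt0 alp (pos _ (nz _ al0)); have := le0 _ al0; lra.
  (* The objective for alpha = 0 need not have a unique minimizer, so n 0 is
     compared with n 1, which is itself feasible for alpha = 0. *)
  have [_ /(_ _ (proj1 (hn _ ler01)))] := hn _ (lexx 0).
  rewrite /tikhonov !mulr0 !mul0r !addr0.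
  have := le0 _ ler01; have := pos _ (nz _ ler01); lra.
- move=> h alpha beta be0 lt_ba eq_n.
  have al0 : 0 <= alpha by apply: le_trans be0 (ltW lt_ba).
  (* At a common minimizer the two ray identities share the inner product with [r] and the term in
     [K], so their difference is [(beta - alpha) * norm2 (n alpha) ^+ 2 = 0]. *)
  have := argmin_ray be0 (hn _ be0); rewrite -eq_n.
  rewrite -(argmin_ray al0 (hn _ al0)) => /addrI /eqP.
  rewrite -subr_eq0 -mulrBl mulf_eq0 subr_eq0 (lt_eqF lt_ba) /= => /eqP.
  by move=> /sqr_norm2_eq0; apply: nN0.
Qed.
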